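(* Let $X$ be a paracompact topological group and $G$ an almost connected subgroup of $X$. Then $$\dim X\le \dim X/G+\dim G.$$
   Context: All topological groups are assumed Hausdorff. $\dim$ denotes the covering dimension (with values possibly $\infty$). A locally compact group $G$ is almost connected if its space of connected components $G/G_0$ (with the quotient topology, $G_0$ the connected component of the identity) is compact; in particular, an almost connected group is locally compact. $X/G$ is the space of cosets $xG$, $x\in X$, with the quotient topology. *)

(* Defs.v *)
From HB Require Import structures.
From mathcomp Require Import all_boot all_order all_algebra.
From mathcomp Require Import generic_quotient.
From mathcomp Require Import all_classical constructive_ereal topology.

Set Implicit Arguments.
Unset Strict Implicit.
Unset Printing Implicit Defensive.

Import Order.TTheory GRing.Theory.
Local Open Scope classical_set_scope.
Local Open Scope card_scope.

HB.mixin Record Group_isTopologicalGroup T of Topological T & Group T := {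
  mulg_continuous : continuous (fun x : T * T => (x.1 * x.2)%g) ;
  invg_continuous : continuous (fun x : T => (x^-1)%g) ;
}.

#[short(type="topologicalGroupType")]
HB.structure Definition TopologicalGroup :=
  {T of Topological T & Group T & Group_isTopologicalGroup T}.

Section Paracompact_and_dimension.
Variable T : topologicalType.

Definition open_cover (C : set (set T)) :=
  (forall U, C U -> open U) /\ \bigcup_(U in C) U = setT.

Definition refines (D C : set (set T)) :=
  forall V, D V -> exists2 U, C U & V `<=` U.

Definition locally_finite (D : set (set T)) :=
  forall x : T, exists2 N, nbhs x N & finite_set [set V | D V /\ V `&` N !=set0].

Definition paracompact_space :=
  forall C, open_cover C ->
    exists D, [/\ open_cover D, refines D C & locally_finite D].

(* Every finite open cover has a finite open refinement such that no point   *)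
(* lies in more than k members, i.e. dim T <= k - 1.                         *)
Definition cover_multiplicity_le (k : nat) :=
  forall C, finite_set C -> open_cover C ->
    exists D, [/\ finite_set D, open_cover D, refines D C &
                  forall x, [set V | D V /\ V x] #<= `I_k].

(* The value is -1 exactly when T is empty. *)
Definition covering_dim : \bar int :=
  match pselect (exists k, `[< cover_multiplicity_le k >]) with
  | left h => ((ex_minn h)%:Z - 1)%R%:E
  | right _ => +oo%E
  end.

End Paracompact_and_dimension.

Section Subgroup.
Variables (X : topologicalGroupType) (G : groupClosed X).

Definition subgroup_type : Type :=
  initial_topology (val : {x : X | x \in G} -> X).

HB.instance Definition _ := Topological.on subgroup_type.
HB.instance Definition _ := SubChoice.copy subgroup_type {x : X | x \in G}.

Let G_closed : group_closed G.
Proof. by split=> [|x y Gx Gy]; [exact: gpred1 | exact: gpredF]. Qed.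

HB.instance Definition _ :=
  SubChoice_isSubGroup.Build X (fun x => x \in G) subgroup_type G_closed.

Let valS_continuous : continuous (val : subgroup_type -> X).
Proof. exact: initial_continuous. Qed.

Let subgroup_mulg_continuous :
  continuous (fun x : subgroup_type * subgroup_type => (x.1 * x.2)%g).
Proof.
apply/continuousP => _ [A oA <-].
have -> : (fun x : subgroup_type * subgroup_type => (x.1 * x.2)%g) @^-1`
      (val @^-1` A) =
    (fun x : subgroup_type * subgroup_type => (val x.1, val x.2)) @^-1`
      ((fun y : X * X => (y.1 * y.2)%g) @^-1` A).
  by apply/funext => x; exact: (congr1 A (valM x.1 x.2)).
apply: open_comp; last by apply: open_comp => // y _; exact: mulg_continuous.
move=> x _; apply: cvg_pair.
  by apply: (@cvg_comp _ _ _ fst val); [exact: cvg_fst | exact: valS_continuous].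
by apply: (@cvg_comp _ _ _ snd val); [exact: cvg_snd | exact: valS_continuous].
Qed.

Let subgroup_invg_continuous : continuous (fun x : subgroup_type => (x^-1)%g).
Proof.
apply/continuousP => _ [A oA <-].
have -> : (fun x : subgroup_type => (x^-1)%g) @^-1` (val @^-1` A) =
    val @^-1` ((fun y : X => (y^-1)%g) @^-1` A).
  by [].
exists ((fun y : X => (y^-1)%g) @^-1` A) => //.
by apply: open_comp => // y _; exact: invg_continuous.
Qed.

HB.instance Definition _ := Group_isTopologicalGroup.Build subgroup_type
  subgroup_mulg_continuous subgroup_invg_continuous.

End Subgroup.

Section Coset_space.
Variables (X : topologicalGroupType) (H : groupClosed X).

(* xH = yH *)
Definition eq_lcoset : rel X := fun x y => (x^-1 * y)%g \in H.

Let eq_lcoset_equiv : equiv_class_of eq_lcoset.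
Proof.
rewrite /eq_lcoset; split=> [x|x y|y x z Hxy Hyz]; first by rewrite mulVg gpred1.
  by rewrite -[RHS]gpredV invgM invgK.
have -> : (x^-1 * z = (x^-1 * y) * (y^-1 * z))%g by rewrite mulgA mulgK.
exact: gpredM.
Qed.

Canonical eq_lcoset_rel := EquivRelPack eq_lcoset_equiv.

Definition coset_space : topologicalType :=
  quotient_topology {eq_quot eq_lcoset}%qT.

End Coset_space.

Section Identity_component.
Variable X : topologicalGroupType.

Definition in_identity_component : {pred X} :=
  fun x => x \in connected_component [set: X] 1%g.

Let in_identity_component_closed : group_closed in_identity_component.
Proof.
have inE0 x : (x \in in_identity_component) <-> connected_component [set: X] 1%g x.
  by rewrite unfold_in /in_identity_component inE.
split=> [|x y /inE0 [A [A1 _ cA] Ax] /inE0 [B [B1 _ cB] By]]; apply/inE0.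
  exact: connected_component_refl.
(* x B^-1 is a connected set through x *)
have cf : continuous (fun z : X => x * z^-1)%g.
  move=> z; apply: (@continuous_comp _ _ _ (fun z : X => (x, (z^-1)%g))
    (fun p : X * X => (p.1 * p.2)%g)); last exact: mulg_continuous.
  by apply: cvg_pair => /=; [exact: cvg_cst | exact: invg_continuous].
have cC : connected [set (x * z^-1)%g | z in B].
  by apply: connected_continuous_connected => //; exact: continuous_subspaceT.
exists (A `|` [set (x * z^-1)%g | z in B]); last by right; exists y.
split=> //; first by left.
apply: connectedU => //; exists x; split=> //; exists 1%g => //.
by rewrite invg1 mulg1.
Qed.

Definition identity_component : groupClosed X :=
  GroupClosed.Pack (GroupClosed.Class
    (isInvClosed.Build X in_identity_component
       (group_closedV in_identity_component_closed))
    (isMul1Closed.Build X in_identity_component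
       (proj1 in_identity_component_closed))
    (isMulClosed.Build X in_identity_component
       (group_closedM in_identity_component_closed))).

End Identity_component.

Definition almost_connected (G : topologicalGroupType) :=
  locally_compact [set: G] /\ compact [set: coset_space (identity_component G)].

(* Main.v *)
Require Import Defs.
From HB Require Import structures.
From mathcomp Require Import all_boot all_order all_algebra.
From mathcomp Require Import finmap generic_quotient.
From mathcomp Require Import all_classical constructive_ereal topology.
From mathcomp Require Import reals normedtype Rstruct.

(* Near 1 there is a closed neighbourhood P such that X -> X/G is perfect on
   every closed subset Q of a translate aP, with fibres that embed in G. The
   Hurewicz inequality for perfect maps on paracompact spaces gives
   dim Q <= dim X/G + dim G, and the locally finite sum theorem passes from the
   sets Q to X.

   For the Hurewicz inequality f : Q -> Y with dim Y = m and fibres of dimension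
   at most n, an open cover of Q has, over a small open set around each point of
   Y, a refinement made of n+1 families of disjoint open sets. By Dowker's
   theorem Y carries arbitrarily fine covers made of m+1 disjoint families, so
   the local refinements must be patched m+1 times. If the refinements used over
   the later families are finer than those used over the earlier ones, each
   patching is a mapping cylinder and raises the order by one only: the resulting
   order is n+m+1. *)

Set Implicit Arguments.
Unset Strict Implicit.
Unset Printing Implicit Defensive.

Import Order.TTheory GRing.Theory Num.Theory numFieldNormedType.Exports.
Local Open Scope classical_set_scope.
Local Open Scope card_scope.

(** * Order of a family and dimension of a subset *)

(** Counting by duplicate-free lists of indices needs no prior finiteness; two indices carrying the
    same set count twice. *)
Definition mult_le (I : choiceType) (T : Type) (W : I -> set T) k x :=
  forall s : seq I, uniq s -> (forall i, i \in s -> W i x) -> (size s <= k)%N.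

Lemma mult_leP (I : choiceType) (T : Type) (W : I -> set T) k x :
  [set i | W i x] #<= `I_k <-> mult_le W k x.
Proof.
split=> [le s us sW|le].
  suff : `I_(size s) #<= `I_k by rewrite card_le_II.
  apply: card_le_trans le.
  have e : [set` s] #= `I_(size s).
    rewrite (_ : [set` s] = [set` [fset i in s]%fset]); last first.
      by apply/seteqP; split=> i /=; rewrite !inE.
    by apply/card_eq_fsetP; rewrite card_fseq undup_id.
  by rewrite -(card_le_eql e); apply: subset_card_le => i /= /sW.
have [/finite_fsetP[F eF]|/(infinite_set_fset k.+1)[B BW kB]] :=
  pselect (finite_set [set i | W i x]).
  rewrite eF; have e : [set` F] #= `I_#|` F| by apply/card_eq_fsetP.
  rewrite (card_le_eql e) card_le_II; apply: le; first exact: fset_uniq.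
  by move=> i iF; have : [set` F] i by []; rewrite -eF.
suff : (k.+1 <= k)%N by rewrite ltnn.
by apply: leq_trans kB (le _ (fset_uniq _) _) => i iB; exact: BW.
Qed.

Lemma mult_le_sub (I : choiceType) (T : Type) (W V : I -> set T) k x :
  (forall i, W i x -> V i x) -> mult_le V k x -> mult_le W k x.
Proof. by move=> WV Vk s us sW; apply: Vk => // i /sW/WV. Qed.

(** Choosing partners under [R] turns a duplicate-free list for [W] into one for [V]. This bounds
    the order when members of [V] are grouped into members of [W]. *)
Lemma mult_le_inj (I J : choiceType) (T : Type) (R : I -> J -> Prop)
    (W : I -> set T) (V : J -> set T) k x :
  (forall i, W i x -> exists2 j, V j x & R i j) ->
  (forall i i' j, R i j -> R i' j -> i = i') ->
  mult_le V k x -> mult_le W k x.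
Proof.
move=> WV Rinj Vk [//|i0 s]; set t := i0 :: s => ut tW.
have [j0 _ _] := WV i0 (tW i0 (mem_head _ _)).
have /choice[h hP] i : exists j, W i x -> V j x /\ R i j.
  have [/WV[j Vj Rij]|nW] := pselect (W i x); first by exists j.
  by exists j0.
rewrite -(size_map h t); apply: Vk => [|j /mapP[i it ->]].
  rewrite map_inj_in_uniq // => i i' it it' e.
  by apply: (Rinj _ _ (h i)); [|rewrite e]; apply: (proj2 (hP _ _)); exact: tW.
exact: (proj1 (hP _ (tW _ it))).
Qed.

(** As in [cover_multiplicity_le], [k] bounds the order, so the dimension is at most [k - 1]. The
    sets are open in the whole space, and finiteness is asked only near [A], so that one infinite
    family can be shrunk on many pieces in turn. *)
Definition dim_le (T : topologicalType) (A : set T) (k : nat) :=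
  forall (I : choiceType) (U : I -> set T), (forall i, open (U i)) ->
    finite_set [set i | U i `&` A !=set0] -> A `<=` \bigcup_i U i ->
  exists W : I -> set T, [/\ forall i, open (W i), forall i, W i `<=` U i,
    A `<=` \bigcup_i W i & forall x, A x -> mult_le W k x].

(** Since [A] is closed, its complement can be added to the cover; the members of the refinement are
    then grouped by an index of some [U i] containing them. *)
Lemma cover_multiplicity_dim_le (T : topologicalType) (A : set T) k :
  cover_multiplicity_le T k -> closed A -> dim_le A k.
Proof.
move=> Tk cA I U oU fU AU.
pose C := [set ~` A] `|` (U @` [set i | U i `&` A !=set0]).
have [||D [_ [oD cD] rD mD]] := Tk C.
- by rewrite finite_setU; split; [exact: finite_set1 | exact: finite_image].
- split=> [V [->|[i _ <-]]|]; [exact: closed_openC | exact: oU |].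
  apply/seteqP; split=> // x _; have [/[dup] Ax /AU[i _ Uix]|nAx] := pselect (A x).
    by exists (U i) => //; right; exists i => //; exists x.
  by exists (~` A) => //; left.
have /choice[g gP] V : exists o : option I, (forall i, o = Some i -> V `<=` U i)
    /\ (D V -> V `&` A !=set0 -> exists i, o = Some i).
  have [[i VU]|nV] := pselect (exists i, V `<=` U i).
    by exists (Some i); split=> [_ [<-]//|_ _]; exists i.
  exists None; split=> // DV [x [Vx Ax]]; have [_ [->|[i _ <-]] VU] := rD _ DV.
    by have := VU x Vx.
  by case: nV; exists i.
exists (fun i => \bigcup_(V in [set V | D V /\ g V = Some i]) V); split.
- by move=> i; apply: bigcup_open => V [/oD].
- by move=> i x [V [_ e] Vx]; exact: (proj1 (gP V) _ e).
- move=> x Ax; have : setT x by []; rewrite -cD => -[V DV Vx].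
  have [|i e] := proj2 (gP V) DV; first by exists x.
  by exists i => //; exists V.
move=> x Ax; have /(mult_leP (fun V => [set y | D V /\ V y])) := mD x.
apply: (mult_le_inj (R := fun i V => g V = Some i)) => [i [V [DV e] Vx]|].
  by exists V.
by move=> i i' V -> [].
Qed.

Lemma dim_le_cover_multiplicity (T : topologicalType) k :
  dim_le [set: T] k -> cover_multiplicity_le T k.
Proof.
move=> Tk C fC [oC cC].
(* The cover is indexed by its own members, with the empty set at every index outside [C]. *)
have [|||W [oW WU cW mW]] := Tk (set T) (fun V => [set x | C V /\ V x]).
- move=> V; have [CV|nCV] := pselect (C V).
    by have -> : [set x | C V /\ V x] = V; [apply/seteqP; split=> x // -[]|exact: oC].
  have -> : [set x | C V /\ V x] = set0 by apply/seteqP; split=> x // -[].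
  exact: open0.
- by apply: sub_finite_set fC => V [x [[]]].
- by move=> x _; have : setT x by []; rewrite -cC => -[V CV Vx]; exists V.
exists (W @` C); split.
- exact: finite_image.
- split=> [_ [V _ <-]//|]; apply/seteqP; split=> // x _.
  by have [//|V _ WVx] := cW x; exists (W V) => //; exists V => //; case: (WU _ _ WVx).
- by move=> _ [V CV <-]; exists V => // x /WU[].
move=> x; apply/(mult_leP (fun V => [set y | (W @` C) V /\ V y])).
apply: (mult_le_inj (R := fun V V' => V = W V')) (mW x I).
  by move=> _ [[V CV <-] Wx]; exists V.
by move=> ? ? ? -> ->.
Qed.

(** * The locally finite sum theorem *)

Definition locally_finite_family (J : choiceType) (T : topologicalType)
    (A : J -> set T) :=
  forall x : T, exists2 N, nbhs x N & finite_set [set j | A j `&` N !=set0].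

Section Locally_finite_sum.
Variables (T : topologicalType) (I J : choiceType).
Variables (U : I -> set T) (A : J -> set T) (k : nat).
Hypotheses (oU : forall i, open (U i)) (cA : forall j, closed (A j)).
Hypotheses (fA : locally_finite_family A) (dA : forall j, dim_le (A j) k).
Hypotheses (UA : forall j, finite_set [set i | U i `&` A j !=set0])
  (AU : forall j, A j `<=` \bigcup_i U i).

(** [p.1] collects the pieces processed so far, and [p.2] is the shrinking of [U] reached at that
    stage. *)
Let ok (p : set J * (I -> set T)) :=
  [/\ forall i, open (p.2 i), forall i, p.2 i `<=` U i,
      forall j, A j `<=` \bigcup_i p.2 i &
      forall j x, p.1 j -> A j x -> mult_le p.2 k x].

Let stage := {p | ok p}.

(* Clause 3 says that a later stage shrinks only on the [A j] it newly
   processes, so near any point a chain of stages is eventually constant. *)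
Let later (s t : stage) :=
  [/\ (sval s).1 `<=` (sval t).1, forall i, (sval t).2 i `<=` (sval s).2 i &
      forall i x, (sval s).2 i x -> ~ (sval t).2 i x ->
        exists2 j, (sval t).1 j /\ ~ (sval s).1 j & A j x].

Let later_refl s : later s s.
Proof. by split; [exact: subset_refl | move=> i; exact: subset_refl |]. Qed.

Let later_trans r s t : later r s -> later s t -> later r t.
Proof.
move=> [rs1 rs2 rs3] [st1 st2 st3]; split.
- by move=> j /rs1/st1.
- by move=> i x /st2/rs2.
move=> i x rx tx; have [sx|sx] := pselect ((sval s).2 i x).
  have [j [tj sj] Ax] := st3 _ _ sx tx.
  by exists j => //; split=> // /rs1.
by have [j [sj rj] Ax] := rs3 _ _ rx sx; exists j => //; split=> //; exact: st1.
Qed.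

Let chain_finite (C : set stage) (s0 : stage) (F : set J) :
  C s0 -> total_on C later -> finite_set F ->
  (forall j, F j -> exists2 s, C s & (sval s).1 j) ->
  exists2 s, C s & F `<=` (sval s).1.
Proof.
move=> Cs0 tC /finite_seqP[js ->]; elim: js => [|j js IH] FC.
  by exists s0.
have [s Cs js_s] := IH (fun j' jjs => FC j' (mem_behead (s := j :: js) jjs)).
have [t Ct jt] := FC j (mem_head _ _).
have [st|ts] := tC _ _ Cs Ct.
  exists t => // j' /=; rewrite inE => /orP[/eqP -> //|/js_s].
  by case: st => st _ _; exact: st.
exists s => // j' /=; rewrite inE => /orP[/eqP ->|/js_s //].
by case: ts => ts _ _; exact: ts.
Qed.

(** A neighbourhood [N] meets finitely many pieces, so some stage has processed all those that the
    chain ever processes; by the third clause of [later], no subsequent stage removes points of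
    [N]. *)
Let chain_stable (C : set stage) (s0 : stage) : C s0 -> total_on C later ->
  forall x : T, exists2 N, nbhs x N & exists2 s, C s &
    forall z i t, N z -> C t -> (sval s).2 i z -> (sval t).2 i z.
Proof.
move=> Cs0 tC x; have [N Nx fN] := fA x; exists N => //.
have [||s Cs sP] := chain_finite Cs0 tC
  (F := [set j | A j `&` N !=set0 /\ exists2 s, C s & (sval s).1 j]).
- by apply: sub_finite_set fN => j [].
- by move=> j [].
exists s => // z i t Nz Ct sz; have [[st1 _ st3]|[_ + _]] := tC _ _ Cs Ct.
  have [//|tz] := pselect ((sval t).2 i z).
  have [j [tj nsj] Ajz] := st3 _ _ sz tz.
  case: nsj; apply: sP; split; last by exists t.
  by exists z.
exact.
Qed.

(** The bound takes the union of the processed sets and the intersection of the shrinkings. Near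
    each point the intersection is that of a single stage, hence open and still covering. *)
Let chain_bound (C : set stage) (s0 : stage) :
  C s0 -> total_on C later -> exists t, forall s, C s -> later s t.
Proof.
move=> Cs0 tC; have stab := chain_stable Cs0 tC.
pose S := \bigcup_(s in C) (sval s).1.
pose W i := \bigcap_(s in C) (sval s).2 i.
have okSW : ok (S, W).
  split=> /=.
  - move=> i; rewrite openE => x Wx; have [N Nx [s Cs sN]] := stab x.
    have [oW _ _ _] := svalP s; rewrite /interior.
    have : nbhs x ((sval s).2 i).
      by apply: open_nbhs_nbhs; split; [exact: oW | exact: Wx].
    by move=> /(filterI Nx); apply: filterS => z [Nz sz] t Ct; exact: sN Nz Ct sz.
  - by move=> i x /(_ _ Cs0); have [_ + _ _] := svalP s0; apply.
  - move=> j x Ax; have [N Nx [s Cs sN]] := stab x.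
    have [_ _ /(_ _ _ Ax)[i _ six] _] := svalP s.
    exists i => // t Ct; exact: sN (nbhs_singleton Nx) Ct six.
  move=> j x [s Cs sj] Ax; have [_ _ _ /(_ _ _ sj Ax)] := svalP s.
  by apply: mult_le_sub => i /(_ _ Cs).
exists (exist _ _ okSW) => s Cs; split=> /=.
- by move=> j sj; exists s.
- by move=> i x /(_ _ Cs).
move=> i x sx nWx; have [N Nx [t Ct tN]] := stab x.
have ntx : ~ (sval t).2 i x.
  by move=> tx; apply: nWx => t' Ct'; exact: tN (nbhs_singleton Nx) Ct' tx.
have [[_ _ st3]|[_ ts2 _]] := tC _ _ Cs Ct; last by have := ts2 _ _ sx.
by have [j [tj sj] Ajx] := st3 _ _ sx ntx; exists j => //; split=> //; exists t.
Qed.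

Let extend (s : stage) j : ~ (sval s).1 j ->
  exists2 t, later s t & (sval t).1 j.
Proof.
move=> nsj; have [oW WU AW mW] := svalP s; set W := (sval s).2 in oW WU AW mW.
have [|V [oV VW AV mV]] := dA oW _ (AW j).
  by apply: sub_finite_set (UA j) => i [x [Wx Ax]]; exists x; split=> //; exact: WU.
(* Nothing changes off [A j], while on [A j] the new set agrees with [V i]; it is open because the
   removed set is closed. *)
pose W' i := W i `\` (A j `\` V i).
have okW : ok ((sval s).1 `|` [set j], W').
  split=> /=.
  - move=> i; rewrite /W' setDE; apply: openI; first exact: oW.
    by apply: closed_openC; rewrite setDE; apply: closedI; [|exact: open_closedC].
  - by move=> i x [/WU].
  - move=> j' x A'x; have [Ax|nAx] := pselect (A j x).
      by have [i _ Vx] := AV x Ax; exists i => //; split; [exact: VW | case].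
    by have [i _ Wx] := AW _ x A'x; exists i => //; split=> // -[].
  move=> j' x [sj'|->] A'x.
    by apply: mult_le_sub (mW _ _ sj' A'x) => i [].
  apply: mult_le_sub (mV _ A'x) => i [Wx nAV].
  by apply: contrapT => nVx; apply: nAV.
exists (exist _ _ okW); [|by right].
split=> [j' sj'|i x []|] /=; [by left | by [] |].
move=> i x Wx nW'x; exists j; first by split; [right|].
by apply: contrapT => nAx; apply: nW'x; split=> // -[].
Qed.

(* Shrink on one [A j] after another; Zorn's lemma replaces the transfinite
   recursion. *)
Lemma locally_finite_sum : exists W : I -> set T,
  [/\ forall i, open (W i), forall i, W i `<=` U i,
      forall j, A j `<=` \bigcup_i W i &
      forall j x, A j x -> mult_le W k x].
Proof.
have ok0 : ok (set0, U) by split=> /= [i|i|j|j x []]; [exact: oU|exact: subset_refl|exact: AU].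
pose R (s t : stage) := `[< later s t >].
have [|||s smax] := @ZL_preorder stage (exist _ _ ok0) R.
- by move=> s; apply/asboolP.
- by move=> r s t /asboolP rs /asboolP st; apply/asboolP; exact: later_trans st.
- move=> C tC; have [[s0 Cs0]|nC] := pselect (exists s, C s); last first.
    by exists (exist _ _ ok0) => s Cs; case: nC; exists s.
  have [|t tP] := chain_bound Cs0.
    by move=> s t Cs Ct; have [/asboolP|/asboolP] := tC _ _ Cs Ct; [left|right].
  by exists t => s Cs; apply/asboolP; exact: tP.
have sT j : (sval s).1 j.
  apply: contrapT => nsj; have [t st tj] := extend nsj.
  by have /smax/asboolP[ts _ _] : R s t by [apply/asboolP]; apply/nsj/ts.
by have [oW WU AW mW] := svalP s; exists (sval s).2; split=> // j x; exact: mW.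
Qed.

End Locally_finite_sum.

(** * Locally finite closed refinements *)

Lemma near_finite (T : topologicalType) (I : choiceType) (F : set I)
    (P : I -> T -> Prop) (x : T) :
  finite_set F -> (forall i, F i -> \forall z \near x, P i z) ->
  \forall z \near x, forall i, F i -> P i z.
Proof.
by move=> /finite_fsetP[S ->] SP; exact: (@filter_bigI _ _ _ _ (nbhs x)).
Qed.

Lemma closed_bigcup_locally_finite (T : topologicalType) (J : choiceType)
    (A : J -> set T) (D : set J) :
  (forall j, closed (A j)) -> locally_finite_family A ->
  closed (\bigcup_(j in D) A j).
Proof.
move=> cA fA; rewrite -[X in closed X]setCK; apply: open_closedC.
rewrite openE => x nAx; have [N Nx fN] := fA x.
have := near_finite (P := fun j z => D j -> ~ A j z) fN.
move=> /(_ x) near_x; rewrite /interior.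
have {}near_x : \forall z \near x, forall j, A j `&` N !=set0 -> D j -> ~ A j z.
  apply: near_x => j _; have [Dj|nDj] := pselect (D j); last by apply: nearW.
  have : nbhs x (~` A j).
    apply: open_nbhs_nbhs; split; first exact: closed_openC.
    by move=> Ax; apply: nAx; exists j.
  by apply: filterS => z nAz _.
apply: filterS (filterI Nx near_x) => z [Nz nz] [j Dj Az].
by apply: (nz j) => //; exists z.
Qed.

(** Paracompactness of a subset, with pieces closed and locally finite in the whole space, so that
    [Y] itself is closed. This form descends along perfect maps without a separation axiom on the
    target. *)
Definition lf_closed_refinable (T : topologicalType) (Y : set T) :=
  forall C : set (set T), (forall U, C U -> open U) ->
    Y `<=` \bigcup_(U in C) U ->
  exists (J : choiceType) (A : J -> set T),
    [/\ forall j, closed (A j), locally_finite_family A, \bigcup_j A j = Y &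
        forall j, A j !=set0 -> exists2 U, C U & A j `<=` U].

(** Regularity gives a cover by open sets whose closures lie in members of [C]. The closures of a
    locally finite refinement stay locally finite, since an open set meeting a closure meets the
    set. *)
Lemma paracompact_lf_closed_refinable (X : topologicalType) :
  regular_space X -> paracompact_space X -> lf_closed_refinable [set: X].
Proof.
move=> regX pX C oC cC.
have [|D [[oD cD] rD fD]] := pX [set V | open V /\ exists2 U, C U & closure V `<=` U].
  split=> [V []//|]; apply/seteqP; split=> // x _.
  have [U CU Ux] := cC x I; have nU : nbhs x U by apply: open_nbhs_nbhs; split=> //; exact: oC.
  have [V Vx VU] := regX x U nU.
  exists V^°; last exact: Vx.
  split; first exact: open_interior.
  by exists U => //; apply: subset_trans VU; apply: closureS; exact: interior_subset.
exists (set X), (fun V => [set x | D V /\ closure V x]); split.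
- move=> V; have [DV|nDV] := pselect (D V); last first.
    have -> : [set x | D V /\ closure V x] = set0 by apply/seteqP; split=> x // -[].
    exact: closed0.
  have -> : [set x | D V /\ closure V x] = closure V.
    by apply/seteqP; split=> x // -[].
  exact: closed_closure.
- move=> x; have [N Nx fN] := fD x; exists N^°; first exact: nbhs_interior.
  apply: sub_finite_set fN => V [z [[DV Vz] Nz]]; split=> //.
  have [y [Vy Ny]] := Vz _ Nz; by exists y.
- apply/seteqP; split=> // x _; have : setT x by [].
  by rewrite -cD => -[V DV Vx]; exists V => //; split=> //; exact: subset_closure.
move=> V [x [DV _]]; have [W [_ [U CU WU]] VW] := rD _ DV.
by exists U => // z [_ Vz]; apply: WU; exact: closureS VW z Vz.
Qed.

(* Michael's argument: the [O j] are the complements of the unions of those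
   members of a second, finer closed refinement which miss [A j], and the [F j]
   the unions of those which meet it. *)
Lemma lf_closed_refinable_expand (T : topologicalType) (Y : set T)
    (C : set (set T)) :
  lf_closed_refinable Y -> (forall U, C U -> open U) ->
  Y `<=` \bigcup_(U in C) U ->
  exists (J : choiceType) (A O F : J -> set T),
    [/\ [/\ forall j, closed (A j), forall j, open (O j) & forall j, closed (F j)],
        locally_finite_family F, \bigcup_j A j = Y,
        forall j, A j `<=` O j /\ O j `&` Y `<=` F j &
        forall j, F j !=set0 -> exists2 U, C U & F j `<=` U].
Proof.
move=> rY oC cC; have [J [A [cA fA UA rA]]] := rY _ oC cC.
have /choice[c cP] j : exists U, A j !=set0 -> C U /\ A j `<=` U.
  have [/rA[U CU AU]|n] := pselect (A j !=set0); first by exists U.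
  by exists set0.
(* Asking [N] to lie in [c j] whenever it meets [A j] keeps [F j] inside [c j]; asking it to meet
   finitely many [A j] makes the [F j] locally finite. *)
have [||K [B [cB fB UB rB]]] := rY [set N | [/\ open N,
  finite_set [set j | A j `&` N !=set0] &
  forall j, A j `&` N !=set0 -> N `<=` c j]].
- by move=> N [].
- move=> y Yy; have [N0 N0y fN0] := fA y.
  have := near_finite (x := y)
    (P := fun j z => (A j y -> c j z) /\ (~ A j y -> ~ A j z)) fN0.
  move=> near_y; have {}near_y : \forall z \near y, forall j, A j `&` N0 !=set0 ->
      (A j y -> c j z) /\ (~ A j y -> ~ A j z).
    apply: near_y => j _; have [Ay|nAy] := pselect (A j y).
      have [|Cc Ac] := cP j; first by exists y.
      have : nbhs y (c j).
        by apply: open_nbhs_nbhs; split; [exact: oC | exact: Ac].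
      exact: filterS.
    have : nbhs y (~` A j).
      by apply: open_nbhs_nbhs; split=> //; exact: closed_openC.
    by apply: filterS => z nAz; split.
  have := filterI N0y near_y; set N := (X in nbhs y X) => Ny.
  exists N^°; last exact: Ny.
  have AN j : A j `&` N^° !=set0 -> A j `&` N0 !=set0.
    by move=> [z [Az /interior_subset[Nz _]]]; exists z.
  split; first exact: open_interior.
    by apply: sub_finite_set fN0 => j /AN.
  move=> j ANj z /interior_subset[_ /(_ j (AN j ANj))[cz _]]; apply: cz.
  apply: contrapT => nAy; have [w [Aw /interior_subset[N0w Nw]]] := ANj.
  by have [_ /(_ nAy)] := Nw j (AN j ANj).
exists J, A.
exists (fun j => ~` \bigcup_(k in [set k | B k `&` A j = set0]) B k).
exists (fun j => \bigcup_(k in [set k | B k `&` A j !=set0]) B k).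
split=> //.
- split=> // j; last exact: closed_bigcup_locally_finite.
  by apply: closed_openC; exact: closed_bigcup_locally_finite.
- move=> x; have [N Nx fN] := fB x; exists N => //.
  have : finite_set (\bigcup_(k in [set k | B k `&` N !=set0])
                       [set j | A j `&` B k !=set0]).
    apply: bigcup_finite => // k [z [Bz _]].
    have [|M [_ fM _] BM] := rB k; first by exists z.
    by apply: sub_finite_set fM => j [w [Aw /BM Mw]]; exists w.
  apply: sub_finite_set => j [z [[k [w [Bw Aw]] Bz] Nz]].
  by exists k; [exists z | exists w].
- move=> j; split=> [x Ax [k /= BA0 Bx]|y [nBy Yy]].
    by have : (B k `&` A j) x by []; rewrite BA0.
  have : (\bigcup_j B j) y by rewrite UB.
  move=> [k _ Bky]; exists k => //=; apply/set0P/negP => /eqP e.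
  by apply: nBy; exists k.
move=> j [x [k0 [w [_ Aw]] _]]; have [|Cc _] := cP j; first by exists w.
exists (c j) => // y [k [z [Bz Az]] By].
have [|M [_ _ Mc] BM] := rB k; first by exists z.
by apply: (Mc j); [exists z; split=> //; exact: BM | exact: BM].
Qed.

(** * Normality and shrinking of open covers *)

Section Closed_set_of_refinable_space.
Variables (X : topologicalType) (P : set X).
Hypotheses (rX : lf_closed_refinable [set: X]) (cP : closed P).

(** In a closed refinement of the cover by the two complements, each piece misses [A] or [B].
    Removing the pieces that miss [A] leaves a neighbourhood of [A], and likewise for [B]. *)
Lemma lf_closed_refinable_normal : normal_space X.
Proof.
apply/(@normal_openP Rdefinitions.R) => A B cA cB AB.
have [||J [F [cF fF UF rF]]] := rX (C := [set ~` A; ~` B]).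
- by move=> U [->|->]; exact: closed_openC.
- move=> x _; have [Ax|nAx] := pselect (A x); last by exists (~` A) => //; left.
  exists (~` B); first by right.
  by move=> Bx; have : (A `&` B) x by []; rewrite AB.
exists (~` \bigcup_(j in [set j | F j `&` A = set0]) F j).
exists (~` \bigcup_(j in [set j | F j `&` B = set0]) F j).
split.
- by apply: closed_openC; exact: closed_bigcup_locally_finite.
- by apply: closed_openC; exact: closed_bigcup_locally_finite.
- by move=> x Ax [j /= e Fx]; have : (F j `&` A) x by []; rewrite e.
- by move=> x Bx [j /= e Fx]; have : (F j `&` B) x by []; rewrite e.
apply/seteqP; split=> // x [nA nB].
have : (\bigcup_j F j) x by rewrite UF.
move=> [j _ Fx]; have [|U [->|->] FU] := rF j; first by exists x.
  by apply: nA; exists j => //=; apply/seteqP; split=> // z [/FU].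
by apply: nB; exists j => //=; apply/seteqP; split=> // z [/FU].
Qed.

Lemma lf_closed_refinable_shrink (I : choiceType) (U : I -> set X) :
  (forall i, open (U i)) -> P `<=` \bigcup_i U i ->
  exists A O : I -> set X, [/\ forall i, closed (A i), forall i, open (O i),
    locally_finite_family O, P `<=` \bigcup_i A i &
    forall i, A i `<=` O i /\ O i `<=` U i].
Proof.
move=> oU PU.
have [||J [A [O [F [[cA oO _] fF UA AOF rF]]]]] :=
    lf_closed_refinable_expand rX (C := [set ~` P] `|` range U).
- by move=> V [->|[i _ <-]]; [exact: closed_openC | exact: oU].
- move=> x _; have [/PU[i _ Ux]|nPx] := pselect (P x).
    by exists (U i) => //; right; exists i.
  by exists (~` P) => //; left.
have OF j : O j `<=` F j by have [_] := AOF j; rewrite setIT.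
have AO j : A j `<=` O j by have [] := AOF j.
have fA : locally_finite_family A.
  move=> x; have [N Nx fN] := fF x; exists N => //.
  by apply: sub_finite_set fN => j [z [/AO/OF Fz Nz]]; exists z.
have /choice[g gP] j : exists o : option I, (forall i, o = Some i -> F j `<=` U i)
    /\ (F j `&` P !=set0 -> exists i, o = Some i).
  have [[i FU]|nV] := pselect (exists i, F j `<=` U i).
    by exists (Some i); split=> [_ [<-]//|_]; exists i.
  exists None; split=> // -[x [Fx Px]]; have [|_ [->|[i _ <-]] FU] := rF j.
  - by exists x.
  - by have := FU x Fx.
  by case: nV; exists i.
exists (fun i => \bigcup_(j in [set j | g j = Some i]) A j).
exists (fun i => \bigcup_(j in [set j | g j = Some i]) O j); split.
- by move=> i; exact: closed_bigcup_locally_finite.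
- by move=> i; apply: bigcup_open => j _; exact: oO.
- move=> x; have [N Nx fN] := fF x; exists N => //.
  have : finite_set (Some @^-1` (g @` [set j | F j `&` N !=set0])).
    by apply: finite_preimage; [move=> ? ? _ _ [] | exact: finite_image].
  apply: sub_finite_set => i [z [[j gj Oz] Nz]].
  by exists j => //; exists z; split=> //; exact: OF.
- move=> x Px; have : (\bigcup_j A j) x by rewrite UA.
  move=> [j _ Ax]; have [|i gj] := proj2 (gP j).
    by exists x; split=> //; exact/OF/AO.
  by exists i => //; exists j.
move=> i; split=> [x [j gj /AO Ox]|x [j gj /OF Fx]]; first by exists j.
by have [/(_ _ gj) FU _] := gP j; exact: FU.
Qed.

End Closed_set_of_refinable_space.

(** * Dowker's theorem and disjoint families *)

Lemma normal_urysohn (R : realType) (X : topologicalType) (A B : set X) :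
  normal_space X -> closed A -> closed B -> A `&` B = set0 ->
  exists f : X -> R, [/\ forall r, open [set x | f x < r]%R,
    forall r, open [set x | r < f x]%R, forall x, (0 <= f x <= 1)%R,
    forall x, A x -> f x = 0%R & forall x, B x -> f x = 1%R].
Proof.
move=> /(@normal_separatorP R X)/(_ A B) sepX cA cB AB.
have uAB := sepX cA cB AB; exists (Urysohn A B); split.
- move=> r; apply: (open_comp (f := Urysohn A B) (D := [set y : R | y < r]%R)).
    by move=> x _; exact: (@Urysohn_continuous X R).
  exact: open_lt.
- move=> r; apply: (open_comp (f := Urysohn A B) (D := [set y : R | r < y]%R)).
    by move=> x _; exact: (@Urysohn_continuous X R).
  exact: open_gt.
- move=> x; have : range (@Urysohn X R A B) (Urysohn A B x) by exists x.
  by move/Urysohn_range; rewrite /= in_itv.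
- by move=> x Ax; apply: (Urysohn_sub0 uAB); exists x.
- by move=> x Bx; apply: (Urysohn_sub1 uAB); exists x.
Qed.

(** Dowker's theorem. Each [B j] meets finitely many members of the expanded cover, so the
    definition of dimension by finite covers applies there, and the locally finite sum theorem
    assembles the shrinkings. *)
Lemma dim_le_open_cover (T : topologicalType) (Y : set T) k (C : set (set T)) :
  lf_closed_refinable Y -> (forall A : set T, closed A -> dim_le A k) ->
  (forall U, C U -> open U) -> Y `<=` \bigcup_(U in C) U ->
  exists (I : choiceType) (U : I -> set T), [/\ forall i, open (U i),
    Y `<=` \bigcup_i U i, forall y, Y y -> mult_le U k y &
    forall i, U i !=set0 -> exists2 V, C V & U i `<=` V].
Proof.
move=> rY dT oC YC.
have [I [A [O [F [[_ oO _] fF AY AOF rF]]]]] := lf_closed_refinable_expand rY oC YC.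
have /choice[c cP] i : exists V, [/\ open V, F i `<=` V & V !=set0 -> C V].
  have [/rF[V CV FV]|n] := pselect (F i !=set0).
    by exists V; split=> //; exact: oC.
  exists set0; split; [exact: open0| by move=> x Fx; apply: n; exists x | by case].
have OF i x : O i x -> Y x -> F i x by move=> Ox Yx; have [_] := AOF i; apply.
have [||J [B [cB fB BY rB]]] :=
    rY [set N | open N /\ finite_set [set i | F i `&` N !=set0]].
- by move=> N [].
- move=> y _; have [N Ny fN] := fF y; exists N^°; last exact: Ny.
  split; first exact: open_interior.
  by apply: sub_finite_set fN => i [z [Fz /interior_subset Nz]]; exists z.
(* [O i] is controlled by [F i] only on [Y]; the intersection with [c i] keeps it inside a member of
   [C] elsewhere too. *)
have [||||W [oW WU BW mW]] :=
    @locally_finite_sum T I J (fun i => O i `&` c i) B k _ cB fB.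
- by move=> i; apply: openI => //; have [] := cP i.
- by move=> j; exact: dT.
- move=> j; have [B0|nB0] := pselect (B j !=set0); last first.
    rewrite (_ : mkset _ = set0) //; apply/seteqP; split=> // i [x [_ Bx]].
    by apply: nB0; exists x.
  have [N [_ fN] BN] := rB _ B0.
  apply: sub_finite_set fN => i [x [[Ox _] Bx]]; exists x; split; last exact: BN.
  by apply: OF => //; rewrite -BY; exists j.
- move=> j x Bx; have Yx : Y x by rewrite -BY; exists j.
  have : (\bigcup_i A i) x by rewrite AY.
  move=> [i _ Ax]; have Ox : O i x by have [AO _] := AOF i; exact: AO.
  by exists i => //; split=> //; have [_ Fc _] := cP i; apply: Fc; exact: OF.
exists I, W; split=> //.
- by move=> y; rewrite -{1}BY => -[j _ /BW].
- by move=> y; rewrite -{1}BY => -[j _ /mW].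
move=> i [x Wx]; exists (c i); last by move=> z /WU[].
by have [_ _] := cP i; apply; exists x; have [] := WU _ _ Wx.
Qed.

(* [O] is a disjoint union of open sets subordinate to [C]; the locally
   constant [phi] sends each point to a member of [C] containing its piece. *)
Definition decomposable (X : topologicalType) (C : set (set X)) (O : set X) :=
  exists phi : X -> set X, forall x, O x ->
    [/\ C (phi x), phi x x & \forall z \near x, O z /\ phi z = phi x].

Lemma decomposable_open (X : topologicalType) (C : set (set X)) (O : set X) :
  decomposable C O -> open O.
Proof.
by move=> [phi phiP]; rewrite openE => x /phiP[_ _]; apply: filterS => z [].
Qed.

(** This is the barycentric subdivision of the nerve. With [l i] supported in [U i], the sets
    [top S], where the values indexed by [S] are positive and exceed all others, are open, and
    disjoint for distinct [S] of equal size; [W c] gathers the [S] with [c + 1] elements. *)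
Lemma order_decomposable (X : topologicalType) (P : set X) (I : choiceType)
    (U : I -> set X) k :
  lf_closed_refinable [set: X] -> closed P -> (forall i, open (U i)) ->
  P `<=` \bigcup_i U i -> (forall x, P x -> mult_le U k x) ->
  exists W : 'I_k -> set X,
    (forall c, decomposable (range U) (W c)) /\ P `<=` \bigcup_c W c.
Proof.
move=> rX cP oU PU mU; pose R := Rdefinitions.R.
have [A [O [cA oO fO PA AOU]]] := lf_closed_refinable_shrink rX cP oU PU.
have AO i : A i `<=` O i by have [] := AOU i.
have OU i : O i `<=` U i by have [] := AOU i.
have /choice[l lP] i : exists f : X -> R, [/\ forall r, open [set x | f x < r]%R,
    forall r, open [set x | r < f x]%R, forall x, (0 <= f x <= 1)%R,
    forall x, (~` O i) x -> f x = 0%R & forall x, A i x -> f x = 1%R].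
  apply: normal_urysohn => //; [exact: lf_closed_refinable_normal | exact: open_closedC |].
  by apply/seteqP; split=> // x [nO /AO].
have l_lt i x r : (l i x < r)%R -> \forall z \near x, (l i z < r)%R.
  by move=> lx; have [ol _ _ _ _] := lP i; apply: open_nbhs_nbhs; split; [exact: ol|].
have l_gt i x r : (r < l i x)%R -> \forall z \near x, (r < l i z)%R.
  by move=> lx; have [_ ol _ _ _] := lP i; apply: open_nbhs_nbhs; split; [exact: ol|].
have l0 i x : (0 < l i x)%R -> O i x.
  move=> lx; apply: contrapT => nO; have [_ _ _ /(_ _ nO) e _] := lP i.
  by rewrite e ltxx in lx.
have l1 i x : A i x -> l i x = 1%R by have [_ _ _ _] := lP i; apply.
have lle1 i x : (l i x <= 1)%R by have [_ _ /(_ x)/andP[]] := lP i.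
have lge0 i x : (0 <= l i x)%R by have [_ _ /(_ x)/andP[]] := lP i.
pose top (S : {fset I}) (x : X) := (forall i, i \in S -> (0 < l i x)%R) /\
  forall i j, i \in S -> j \notin S -> (l j x < l i x)%R.
have top_near S x : top S x -> \forall z \near x, top S z.
  (* Only the finitely many indices whose [O j] meets [N] compete with [S]; the other functions
     vanish on [N]. *)
  move=> [S0 Slt]; have [N Nx fN] := fO x.
  have near0 : \forall z \near x, forall i, i \in S -> (0 < l i z)%R.
    apply: (near_finite (F := [set` S]) (P := fun i z => (0 < l i z)%R)) => // i iS.
    exact/l_gt/S0.
  have near1 : \forall z \near x, forall i, i \in S ->
      forall j, O j `&` N !=set0 -> j \notin S -> (l j z < l i z)%R.
    apply: (near_finite (F := [set` S]) (P := fun i z => forall j,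
      O j `&` N !=set0 -> j \notin S -> (l j z < l i z)%R)) => // i iS.
    apply: (near_finite (F := [set j | O j `&` N !=set0])
      (P := fun j z => j \notin S -> (l j z < l i z)%R)) => // j _.
    have [jS|njS] := boolP (j \in S); first by apply: nearW.
    have lt_ji := Slt _ _ iS njS.
    have [lt_jm lt_mi] := midf_lt lt_ji.
    apply: filterS (filterI (l_lt _ _ _ lt_jm) (l_gt _ _ _ lt_mi)) => z [zj zi] _.
    exact: lt_trans zj zi.
  apply: filterS (filterI Nx (filterI near0 near1)) => z [Nz [z0 z1]].
  split=> // i j iS njS; have [Oj|nOj] := pselect (O j z).
    by apply: z1 => //; exists z.
  apply: le_lt_trans (z0 _ iS); rewrite leNgt; apply/negP => /l0; exact: nOj.
have top_sub S S' x : #|` S| = #|` S'| -> top S x -> top S' x ->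
    forall i, i \in S -> i \in S'.
  move=> eS [_ tS] [_ tS'] i iS; apply: contraT => niS'.
  have [S'S|/fsubsetPn[j jS' njS]] := boolP (S' `<=` S)%fset.
    have : (i |` S' `<=` S)%fset by rewrite fsubUset fsub1set iS.
    by move/fsubset_leq_card; rewrite cardfsU1 niS' eS ltnn.
  by have := lt_trans (tS _ _ iS njS) (tS' _ _ jS' niS'); rewrite ltxx.
have top_uniq S S' x : #|` S| = #|` S'| -> top S x -> top S' x -> S = S'.
  by move=> e tS tS'; apply/fsetP => i; apply/idP/idP;
    [exact: (top_sub _ _ _ e tS tS') | exact: (top_sub _ _ _ (esym e) tS' tS)].
have /choice[h hP] (S : {fset I}) :
    exists V : set X, S != fset0 -> exists2 i, i \in S & V = U i.
  have [->|/fset0Pn[i iS]] := eqVneq S fset0; first by exists set0.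
  by exists (U i) => _; exists i.
pose W (c : 'I_k) := [set x | exists2 S : {fset I}, #|` S| = c.+1 & top S x].
exists W; split=> [c|x Px].
  have /choice[s sP] x : exists S : {fset I}, W c x -> #|` S| = c.+1 /\ top S x.
    by have [[S cS tS]|n] := pselect (W c x); [exists S | exists fset0].
  exists (h \o s) => x Wx; have [cs ts] := sP x Wx.
  have [|i i_s e] := hP (s x); first by rewrite -cardfs_gt0 cs.
  rewrite /= e; split; first by exists i.
    by apply/OU/l0; case: ts => ts _; exact: ts.
  apply: filterS (top_near _ _ ts) => z tz; have Wz : W c z by exists (s x).
  split=> //; have [cz tsz] := sP z Wz.
  by rewrite -e (top_uniq _ _ z _ tsz tz) // cz cs.
(* The witness is the set of indices whose function attains its maximum 1 at [x]. It is nonempty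
   because the [A i] cover [P], and has at most [k] elements by the order of [U]. *)
have [i0 _ Ai0] := PA x Px.
have fS : finite_set [set i | l i x = 1%R].
  have [N /nbhs_singleton Nx fN] := fO x; apply: sub_finite_set fN => i /= li.
  by exists x; split=> //; apply: l0; rewrite li.
pose S := fset_set [set i | l i x = 1%R].
have SE i : (i \in S) = (l i x == 1%R).
  by rewrite in_fset_set //; apply/idP/idP => [/set_mem/= ->//|/eqP ?]; exact: mem_set.
have S_gt0 : (0 < #|` S|)%N.
  by rewrite cardfs_gt0; apply/fset0Pn; exists i0; rewrite SE l1.
have S_le : (#|` S| <= k)%N.
  apply: mU Px _ (fset_uniq S) _ => i.
  by rewrite SE => /eqP li; apply/OU/l0; rewrite li.
have lt_k : (#|` S|.-1 < k)%N by rewrite prednK.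
exists (Ordinal lt_k) => //; exists S; first by rewrite /= prednK.
split=> [i|i j]; rewrite !SE; first by move/eqP ->.
by move=> /eqP -> nj; rewrite lt_neqAle nj lle1.
Qed.

(** * Patching covers *)

Lemma decomposable_refine (X : topologicalType) (C C' : set (set X)) (O : set X) :
  (forall U, C U -> U !=set0 -> exists2 V, C' V & U `<=` V) ->
  decomposable C O -> decomposable C' O.
Proof.
move=> CC' [phi phiP].
have /choice[w wP] u : exists w, C u -> u !=set0 -> C' w /\ u `<=` w.
  have [[Cu u0]|nCu] := pselect (C u /\ u !=set0).
    by have [w C'w uw] := CC' u Cu u0; exists w.
  by exists set0 => Cu u0; case: nCu.
exists (w \o phi) => x Ox; have [Cx px near_x] := phiP x Ox.
have [|C'x uw] := wP _ Cx; first by exists x.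
split; [exact: C'x | exact: uw |].
by apply: filterS near_x => z [Oz /= ->].
Qed.

Lemma decomposable_openI (X : topologicalType) (C : set (set X)) (O V : set X) :
  open V -> decomposable C O -> decomposable C (O `&` V).
Proof.
move=> oV [phi phiP]; exists phi => x [Ox Vx]; have [Cx px near_x] := phiP x Ox.
have Vx' : nbhs x V by apply: open_nbhs_nbhs.
by split=> //; apply: filterS (filterI near_x Vx') => z [[Oz ->] Vz].
Qed.

(* The transition zones [A i `&` B i] lie between [H] and the complement of [E]
   and are pairwise disjoint. *)
Lemma normal_thresholds (X : topologicalType) (E H : set X) (r : nat) :
  normal_space X -> open E -> closed H -> H `<=` E ->
  exists (A B : 'I_r -> set X) (B0 : set X),
    [/\ [/\ forall i, open (A i), forall i, open (B i) & open B0],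
        forall i x, A i x \/ B i x, forall i, B i `<=` E,
        H `<=` B0 /\ B0 `<=` E &
        (forall i x, A i x -> ~ B0 x) /\
        forall i j x, A i x -> B i x -> A j x -> B j x -> i = j].
Proof.
move=> nX oE cH HE; pose R := Rdefinitions.R.
have [||f [f_lt f_gt f01 f0 f1]] := @normal_urysohn R X (~` E) H nX _ cH.
- exact: open_closedC.
- by apply/seteqP; split=> // x [nE /HE].
(* The interval from 0 to 1 is cut into [2r + 1] equal parts: zone [i] runs from level [2i + 1] to
   level [2i + 2], and [B0] lies above level [2r], beyond all zones. *)
pose d : R := ((r.*2).+1%:R)%R.
have d_gt0 : (0 < d)%R by rewrite ltr0n.
pose lev (m : nat) : R := (m%:R / d)%R.
have lev_lt m p : (m < p)%N -> (lev m < lev p)%R.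
  by move=> mp; rewrite ltr_pM2r ?invr_gt0 // ltr_nat.
have lev_le m p : (m <= p)%N -> (lev m <= lev p)%R.
  by move=> mp; rewrite ler_pM2r ?invr_gt0 // ler_nat.
have fE m x : (lev m < f x)%R -> E x.
  move=> mx; apply: contrapT => nE; move: mx; rewrite f0 // ltNge.
  by rewrite (_ : 0%R = lev 0) ?lev_le // /lev mul0r.
exists (fun i : 'I_r => [set x | f x < lev (i.*2).+2]%R).
exists (fun i : 'I_r => [set x | lev (i.*2).+1 < f x]%R).
exists [set x | lev r.*2 < f x]%R; split.
- by split=> [i|i|]; [exact: f_lt | exact: f_gt | exact: f_gt].
- move=> i x /=; have [|le] := ltP (f x) (lev (i.*2).+2); first by left.
  by right; apply: lt_le_trans le; exact: lev_lt.
- by move=> i x /fE.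
- split=> x; last exact: fE.
  move=> Hx /=; rewrite f1 //; apply: (lt_le_trans (lev_lt _ (r.*2).+1 _)) => //.
  by rewrite /lev divff // lt0r_neq0.
split=> [i x /= lt1 lt2|].
  have := lt_trans lt2 lt1; rewrite ltNge lev_le //.
  by rewrite -doubleS leq_double.
have half (i j : 'I_r) x : (i < j)%N -> (f x < lev (i.*2).+2)%R ->
    (lev (j.*2).+1 < f x)%R -> False.
  move=> ij lt1 lt2; have := lt_trans lt2 lt1; rewrite ltNge lev_le //.
  by rewrite -doubleS; apply: leq_trans (leqnSn _); rewrite leq_double.
move=> i j x /= Ai Bi Aj Bj; apply: val_inj => /=.
have [ij|ji|//] := ltngtP (i : nat) j.
  by case: (half _ _ _ ij Ai Bj).
by case: (half _ _ _ ji Aj Bi).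
Qed.

Lemma sum_bool_le1 (I : finType) (b : I -> bool) :
  (forall i j, b i -> b j -> i = j) -> (\sum_i b i <= 1)%N.
Proof.
move=> b1; have [[i bi]|nb] := pselect (exists i, b i); last first.
  by rewrite big1 // => i _; apply/eqP; rewrite eqb0; apply/negP => bi; apply: nb; exists i.
rewrite (bigD1 i) //= bi big1 // => j ji; apply/eqP; rewrite eqb0.
by apply: contra ji => bj; apply/eqP; exact: b1.
Qed.

Section Glue.
Variables (X : topologicalType) (P : set X) (n N : nat).
Variables (C C' Lab : set (set X)) (L : set X -> 'I_n.+1 -> set X).
Variables (I : finType) (M : I -> set X) (E H : set X).
Hypotheses (nX : normal_space X) (C'C : refines C' C).
Hypotheses (dL : forall e c, Lab e -> decomposable C (L e c)).
Hypothesis LP : forall e x, Lab e -> P x -> e x -> exists c, L e c x.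
Hypothesis C'L : forall u e, C' u -> Lab e ->
  exists c, forall x, P x -> u x -> e x -> L e c x.
Hypotheses (dM : forall i, decomposable C' (M i)) (nN : (n <= N)%N).
Hypothesis mM : forall x, P x -> (\sum_i `[< M i x >] <= N)%N.
Hypotheses (dE : decomposable Lab E) (cH : closed H) (HE : H `<=` E).

(* The mapping cylinder of the refinement [M -> L]: moving into [E], the members
   of [M] are merged one at a time into the member of [L] which contains them,
   so that at any point at most one member of [M] is counted twice. *)
Lemma glue_decomposable : exists (J : finType) (W : J -> set X),
  [/\ forall j, decomposable C (W j),
      forall x, P x -> H x \/ (exists i, M i x) -> exists j, W j x &
      forall x, P x -> (\sum_j `[< W j x >] <= N.+1)%N].
Proof.
have [A [B [B0 [[oA oB oB0] AB BE [HB0 B0E] [AB0 zone]]]]] :=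
  @normal_thresholds X E H #|I| nX (decomposable_open dE) cH HE.
have [eta etaP] := dE.
have /choice[mu muP] := dM.
have /choice[psi psiP] (p : set X * 'I_n.+1) : exists phi : X -> set X,
    Lab p.1 -> forall x, L p.1 p.2 x ->
    [/\ C (phi x), phi x x & \forall z \near x, L p.1 p.2 z /\ phi z = phi x].
  have [Lp|nLab] := pselect (Lab p.1).
    by have [phi phiP] := dL p.2 Lp; exists phi.
  by exists (fun=> set0).
(* [gam] selects, for a piece [u] of [C'] and a label [e], a member of the refinement [L e] that
   contains [u] over [e]. *)
have /choice[gam gamP] (p : set X * set X) : exists c : 'I_n.+1, C' p.1 -> Lab p.2 ->
    forall x, P x -> p.1 x -> p.2 x -> L p.2 c x.
  have [[Cp Lp]|n12] := pselect (C' p.1 /\ Lab p.2).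
    by have [c cP] := C'L Cp Lp; exists c.
  by exists ord0 => Cp Lp; case: n12.
pose rk i := enum_rank i : 'I_#|I|.
(* Once a point enters [B (rk i)], its piece of [M i] is represented by the member of [L] containing
   it over the label [eta x]. On [B0] all of [L] is present, whatever [M] covers. *)
pose V (c : 'I_n.+1) := [set x | [/\ E x, L (eta x) c x & B0 x \/
  exists2 i, M i x /\ B (rk i) x & gam (mu i x, eta x) = c]].
exists (I + 'I_n.+1)%type, (fun j => match j with
  | inl i => M i `&` A (rk i) | inr c => V c end); split.
- move=> [i|c]; first apply: decomposable_openI => //.
    by apply: decomposable_refine (dM i) => u Cu _; exact: C'C.
  exists (fun x => psi (eta x, c) x) => x [Ex Lx BMx].
  have [Labx _ near_eta] := etaP x Ex.
  have [Cx px near_psi] := psiP (eta x, c) Labx x Lx; split=> //.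
  have near_BM : \forall z \near x, E z /\ eta z = eta x -> B0 z \/
      exists2 i, M i z /\ B (rk i) z & gam (mu i z, eta z) = c.
    case: BMx => [B0x|[i [Mx Bx] gx]].
      have : nbhs x B0 by apply: open_nbhs_nbhs.
      by apply: filterS => z B0z _; left.
    have nB : nbhs x (B (rk i)) by apply: open_nbhs_nbhs.
    have [_ _ near_mu] := muP i x Mx.
    apply: filterS (filterI nB near_mu) => z [Bz [Mz muz]] [_ ez].
    by right; exists i => //; rewrite muz ez.
  apply: filterS (filterI near_eta (filterI near_psi near_BM)).
  move=> z [[Ez ez] [[Lz pz] BMz]]; rewrite /V /= ez; split=> //; split=> //.
  by rewrite -ez; exact: BMz.
- move=> x Px [Hx|[i Mx]].
    have Ex := HE Hx; have [Labx ex _] := etaP x Ex.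
    have [c Lx] := LP Labx Px ex; exists (inr c).
    by split=> //; left; exact: HB0.
  have [Ax|Bx] := AB (rk i) x; first by exists (inl i).
  have Ex := BE _ _ Bx; have [Labx ex _] := etaP x Ex.
  have [Cx mx _] := muP i x Mx.
  exists (inr (gam (mu i x, eta x))); split=> //; last by right; exists i.
  exact: (gamP (mu i x, eta x)).
move=> x Px; rewrite big_sumType /=.
have [B0x|nB0x] := pselect (B0 x).
  rewrite big1 => [|i _]; last first.
    by apply/eqP; rewrite eqb0; apply/negP => /asboolP[_ /AB0].
  rewrite add0n; apply: (@leq_trans (\sum_(c < n.+1) 1)).
    by apply: leq_sum => c _; exact: leq_b1.
  by rewrite sum1_card card_ord ltnS.
(* Outside [B0], every [V c] through [x] is charged to some [i] with [x] in both [M i] and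
   [B (rk i)], and no [i] is charged twice. *)
have le_V : (\sum_(c < n.+1) `[< V c x >] <= \sum_i `[< (M i `&` B (rk i)) x >])%N.
  apply: (@leq_trans (\sum_(c < n.+1) \sum_i
      (`[< (M i `&` B (rk i)) x >] && (gam (mu i x, eta x) == c)))%N).
    apply: leq_sum => c _; case: asboolP => // -[Ex Lx [//|[i MBx gx]]].
    by rewrite (bigD1 i) //= gx eqxx andbT (asboolT MBx).
  rewrite exchange_big; apply: leq_sum => i _.
  rewrite (bigD1 (gam (mu i x, eta x))) //= eqxx andbT big1 ?addn0 // => c ne.
  by rewrite eq_sym (negbTE ne) andbF.
apply: leq_trans (leq_add (leqnn _) le_V) _; rewrite -big_split /=.
(* An index counts twice only in its own transition zone; the zones being disjoint, this adds at
   most one in total. *)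
apply: (@leq_trans (\sum_i (`[< M i x >] +
    `[< [/\ M i x, A (rk i) x & B (rk i) x] >])))%N.
  apply: leq_sum => i _; case: (pselect (M i x)) => [Mx|nMx]; last first.
    by rewrite !asboolF // => -[].
  rewrite (asboolT Mx).
  have [Ax|nAx] := pselect (A (rk i) x); last first.
    by rewrite asboolF => [|[]//]; apply: leq_trans (leq_b1 _) (leq_addr _ _).
  have [Bx|nBx] := pselect (B (rk i) x); last first.
    rewrite addnC asboolF => [|[]//].
    by apply: leq_trans (leq_b1 _) (leq_addr _ _).
  by rewrite !asboolT.
rewrite big_split /= -addn1; apply: leq_add; first exact: mM.
apply: sum_bool_le1 => i j /asboolP[_ Ai Bi] /asboolP[_ Aj Bj].
by apply: enum_rank_inj; exact: zone Ai Bi Aj Bj.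
Qed.

End Glue.

(** * Disjoint families over the base of a map *)

Section Hurewicz.
Variables (X T : topologicalType) (f : X -> T) (P : set X) (n : nat).
Hypotheses (nX : normal_space X) (cf : continuous f).
Hypothesis rY : lf_closed_refinable (f @` P).
Hypothesis fib : forall C : set (set X), (forall U, C U -> open U) ->
  P `<=` \bigcup_(U in C) U -> forall y, (f @` P) y ->
  exists2 V : set T, open V /\ V y & exists L : 'I_n.+1 -> set X,
    (forall c, decomposable C (L c)) /\
    forall x, P x -> V (f x) -> exists c, L c x.

(* Induction: the pieces over [E ord0] use local refinements of [C], those over
   the other [E c] refine a cover [C'] which is finer than all the former. *)
Lemma hurewicz_cover (k : nat) (C : set (set X)) :
  (forall U, C U -> open U) -> P `<=` \bigcup_(U in C) U ->
  exists D : set (set T), [/\ forall d, D d -> open d,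
    f @` P `<=` \bigcup_(d in D) d &
    forall E H : 'I_k -> set X,
      (forall c, decomposable [set f @^-1` d | d in D] (E c)) ->
      (forall c, closed (H c)) -> (forall c, H c `<=` E c) ->
    exists (I : finType) (M : I -> set X), [/\ forall i, decomposable C (M i),
      forall x, P x -> (exists c, H c x) -> exists i, M i x &
      forall x, P x -> (\sum_i `[< M i x >] <= n + k)%N]].
Proof.
elim: k C => [|k IH] C oC PC.
  (* The bound [n] for the empty family is what the first patching raises to [n + 1], the size of
     one local refinement. *)
  exists [set setT]; split=> [d ->|y _|E H _ _ _]; [exact: openT | by exists setT|].
  exists 'I_0, (fun=> set0); split=> [[]//|x _ [[]//]|x _].
  by rewrite big_ord0.
have [||J [A [O [F [[cA oO cF] fF AY AOF rF]]]]] := lf_closed_refinable_expand rY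
    (C := [set V | open V /\ exists L : 'I_n.+1 -> set X,
      (forall c, decomposable C (L c)) /\
      forall x, P x -> V (f x) -> exists c, L c x]).
- by move=> V [].
- by move=> y /(fib oC PC)[V [oV Vy] LP]; exists V.
have /choice[L LP] j : exists L : 'I_n.+1 -> set X,
    (forall c, decomposable C (L c)) /\
    forall x, P x -> F j (f x) -> exists c, L c x.
  have [/rF[V [_ [L [dL LV]]] FV]|nF] := pselect (F j !=set0).
    by exists L; split=> // x Px /FV; exact: LV.
  exists (fun=> set0); split=> [c|x Px Fx]; first by exists (fun=> set0).
  by case: nF; exists (f x).
(* Over each [F j], a member of [C'] lies in a single member of [L j]. Such sets cover [P]: near
   [f x] only finitely many [F j] occur, and those missing [f x] can be avoided. *)
pose C' := [set u | [/\ open u, exists2 w, C w & u `<=` w &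
  forall j, exists c, forall z, u z -> F j (f z) -> L j c z]].
have [||D' [oD' YD' D'P]] := IH C'.
- by move=> u [].
- move=> x Px; have [w Cw wx] := PC x Px.
  have [N Nfx fN] := fF (f x).
  have /choice[g gP] j : exists c, F j (f x) -> L j c x.
    have [/(proj2 (LP j) x Px)[c Lx]|nF] := pselect (F j (f x)); first by exists c.
    by exists ord0.
  have near_x : \forall z \near x, forall j, F j `&` N !=set0 ->
      (F j (f x) -> L j (g j) z) /\ (~ F j (f x) -> ~ F j (f z)).
    apply: (near_finite (F := [set j | F j `&` N !=set0]) (P := fun j z =>
      (F j (f x) -> L j (g j) z) /\ (~ F j (f x) -> ~ F j (f z)))) => // j _.
    have [Fx|nFx] := pselect (F j (f x)).
      have : nbhs x (L j (g j)).
        apply: open_nbhs_nbhs; split; last exact: gP.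
        by have [/(_ (g j))/decomposable_open] := LP j.
      exact: filterS.
    have : nbhs x (f @^-1` (~` F j)).
      apply: cf; apply: open_nbhs_nbhs; split=> //; exact: closed_openC.
    by apply: filterS => z nFz; split.
  have nw : nbhs x w by apply: open_nbhs_nbhs; split=> //; exact: oC.
  have nN : nbhs x (f @^-1` N) by exact: cf.
  have := filterI nw (filterI nN near_x); set u := (X in nbhs x X) => ux.
  exists u^°; last exact: ux.
  split; [exact: open_interior | by exists w => // z /interior_subset[] |].
  move=> j; exists (g j) => z /interior_subset[wz [Nz /(_ j) uz]] Fz.
  have [|Lz nFz] := uz; first by exists (f z).
  by apply: Lz; apply: contrapT => /nFz.
(* Refining [D'] serves the induction hypothesis; lying in one [O j] assigns to each piece of
   [E ord0] a refinement [L j]. *)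
pose D := [set d | [/\ open d, exists2 d', D' d' & d `<=` d' &
  exists j, d `<=` O j]].
exists D; split=> [d []//|y Yy|E H dE cH HE].
  have [d' D'd' d'y] := YD' y Yy.
  have : (\bigcup_j A j) y by rewrite AY.
  move=> [j _ Ay]; exists (d' `&` O j); last first.
    by split=> //; have [AO _] := AOF j; exact: AO.
  split; first by apply: openI => //; exact: oD'.
    by exists d' => // z [].
  by exists j => z [].
have [|||I [M [dM MH mM]]] := D'P (E \o lift ord0) (H \o lift ord0).
- move=> c; apply: decomposable_refine (dE _) => _ [d [_ [d' D'd' dd'] _] <-] _.
  by exists (f @^-1` d') => [|z /dd']; first by exists d'.
- by move=> c; exact: cH.
- by move=> c; exact: HE.
pose Lab := [set f @^-1` d | d in D].
have /choice[j jP] e : exists o : option J, Lab e ->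
    exists2 j, o = Some j & forall x, P x -> e x -> F j (f x).
  have [[d [_ _ [j dO]] <-]|nLab] := pselect (Lab e); last by exists None.
  exists (Some j) => _; exists j => // x Px /dO Ox; have [_ OF] := AOF j.
  by apply: OF; split=> //; exists x.
pose L' e := if j e is Some j then L j else fun=> set0.
have [||||J' [W [dW WP mW]]] := @glue_decomposable X P n (n + k) C C' Lab L' I M
    (E ord0) (H ord0) nX _ _ _ _ dM (leq_addr _ _) mM (dE ord0) (cH ord0) (HE ord0).
- by move=> u [].
- by move=> e c /jP[j' ej _]; rewrite /L' ej; have [] := LP j'.
- move=> e x /jP[j' ej je] Px ex; rewrite /L' ej; have [_] := LP j'.
  by apply=> //; exact: je.
- move=> u e [_ _ /[swap]] /jP[j' ej je] /(_ j')[c uL]; exists c => x Px ux ex.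
  by rewrite /L' ej; apply: uL => //; exact: je.
exists J', W; split=> // [x Px [c Hx]|x Px]; last by rewrite addnS; exact: mW.
apply: WP => //; case: (unliftP ord0 c) Hx => [c' ->|->] Hx; last by left.
by right; apply: MH => //; exists c'.
Qed.

End Hurewicz.

(** * The Hurewicz inequality for perfect maps *)

Lemma sum_mult_le (I : finType) (T : Type) (M : I -> set T) k x :
  (\sum_i `[< M i x >] <= k)%N -> mult_le M k x.
Proof.
move=> le_k s us sM; apply: leq_trans le_k.
rewrite -(card_uniqP us) -sum1_card big_mkcond /=; apply: leq_sum => i _.
by case: ifP => // /sM Mi; rewrite asboolT.
Qed.

Lemma dim_le0 (T : topologicalType) (A : set T) k : ~ (A !=set0) -> dim_le A k.
Proof.
move=> A0 I U oU fU AU; exists U; split=> // [i|x Ax]; first exact: subset_refl.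
by case: A0; exists x.
Qed.

(* The library states this for pointed spaces. *)
Lemma compact_cover_compact (T : topologicalType) (A : set T) :
  compact A -> cover_compact A.
Proof.
have [[x Ax]|nA] := pselect (A !=set0); last first.
  by move=> _ I D f _ _; exists fset0 => // x Ax; case: nA; exists x.
pose Tp : ptopologicalType := HB.pack T (isPointed.Build T x).
by move=> cA; have : @compact Tp A by []; rewrite compact_cover.
Qed.

(** The restriction of [f] to [P] is perfect in the usual sense, with images closed in the whole of
    [T]; continuity is assumed separately. *)
Definition perfect_on (X T : topologicalType) (f : X -> T) (P : set X) :=
  [/\ closed P, forall C, closed C -> C `<=` P -> closed (f @` C) &
      forall y, compact (P `&` f @^-1` [set y])].

Section Perfect.
Variables (X T : topologicalType) (f : X -> T) (P : set X).
Hypotheses (hX : hausdorff_space X) (rX : lf_closed_refinable [set: X]).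
Hypotheses (cf : continuous f) (pf : perfect_on f P).

Lemma perfect_on_tube (O : set X) (y : T) : open O ->
  P `&` f @^-1` [set y] `<=` O ->
  exists2 V, open V /\ V y & forall x, P x -> V (f x) -> O x.
Proof.
move=> oO yO; have [cP fP _] := pf; exists (~` (f @` (P `\` O))).
  split; last by move=> [x [Px nOx] fx]; apply: nOx; exact: yO.
  apply: closed_openC; apply: fP => [|x []//]; rewrite setDE.
  by apply: closedI => //; exact: open_closedC.
by move=> x Px nV; apply: contrapT => nOx; apply: nV; exists x.
Qed.

(** The pieces are images of closed pieces of [P]. For local finiteness at [y], finitely many open
    sets, each meeting finitely many pieces, cover the compact fibre and hence a tube around it. *)
Lemma perfect_image_lf_closed_refinable : lf_closed_refinable (f @` P).
Proof.
move=> C oC YC; have [cP fP kP] := pf.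
have [||J [A [cA fA AX rA]]] := rX (C := [set ~` P] `|` [set f @^-1` c | c in C]).
- move=> U [->|[c Cc <-]]; first exact: closed_openC.
  by apply: open_comp => [x _|]; [exact: cf | exact: oC].
- move=> x _; have [Px|nPx] := pselect (P x); last by exists (~` P) => //; left.
  have [|c Cc cfx] := YC (f x); first by exists x.
  by exists (f @^-1` c) => //; right; exists c.
exists J, (fun j => f @` (A j `&` P)); split.
- by move=> j; apply: fP => [|x []//]; exact: closedI.
- move=> y; have /choice[N NP] x : exists N, [/\ open N, N x &
      finite_set [set j | A j `&` N !=set0]].
    have [N Nx fN] := fA x; exists N^°; split; [exact: open_interior | exact: Nx |].
    by apply: sub_finite_set fN => j [z [Az /interior_subset Nz]]; exists z.
  have := compact_cover_compact (kP y).
  move=> /(_ X setT N)[|x _|S _ yS].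
  - by move=> x _; have [] := NP x.
  - by exists x => //; have [] := NP x.
  have [|V [oV Vy] VS] := perfect_on_tube _ yS.
    by apply: bigcup_open => x _; have [] := NP x.
  exists V; first by apply: open_nbhs_nbhs.
  have : finite_set (\bigcup_(x in [set` S]) [set j | A j `&` N x !=set0]).
    by apply: bigcup_finite => // x _; have [] := NP x.
  apply: sub_finite_set => j [_ [[z [Az Pz] <-] Vz]].
  by have [x Sx Nz] := VS z Pz Vz; exists x => //; exists z.
- apply/seteqP; split=> [_ [j _ [x [_ Px] <-]]|_ [x Px <-]]; first by exists x.
  have : (\bigcup_j A j) x by rewrite AX.
  by move=> [j _ Ax]; exists j => //; exists x.
move=> j [_ [x [Ax Px] _]]; have [|_ [->|[c Cc <-]] AU] := rA j; first by exists x.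
  by have := AU x Ax.
by exists c => // _ [z [/AU fz _] <-].
Qed.

Section Dimension.
Variables (m n : nat).
Hypothesis dT : forall A : set T, closed A -> dim_le A m.+1.
Hypothesis dfib : forall y, dim_le (P `&` f @^-1` [set y]) n.+1.

(** A finite subcover of the compact fibre is shrunk to order [n + 1] and split into [n + 1]
    disjoint families; by the tube property these still cover over a neighbourhood of [y]. *)
Let fibre_decomposable (C : set (set X)) : (forall U, C U -> open U) ->
  P `<=` \bigcup_(U in C) U -> forall y, (f @` P) y ->
  exists2 V : set T, open V /\ V y & exists L : 'I_n.+1 -> set X,
    (forall c, decomposable C (L c)) /\
    forall x, P x -> V (f x) -> exists c, L c x.
Proof.
move=> oC PC y _; have [cP fP kP] := pf; set K := P `&` f @^-1` [set y].
have [//||S SC KS] := @compact_cover_compact X K (kP y) _ C id.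
  by move=> x [/PC].
have oU V : open [set x | V \in S /\ V x].
  have [VS|nVS] := boolP (V \in S).
    have -> : [set x | is_true true /\ V x] = V by apply/seteqP; split=> x // -[].
    by apply/oC/set_mem/SC.
  by have -> : [set x | is_true false /\ V x] = set0;
    [apply/seteqP; split=> x // -[] | exact: open0].
have [||W [oW WU KW mW]] := @dfib y _ _ oU.
- by apply: (@sub_finite_set _ _ [set` S]) => // V [x [[]]].
- by move=> x /KS[V SV Vx]; exists V.
have [|L [dL KL]] := order_decomposable rX _ oW KW mW.
  by apply: compact_closed => //; exact: kP.
have dL' c : decomposable C (L c).
  apply: decomposable_refine (dL c) => _ [V _ <-] [x /WU[VS _]].
  by exists V => [|z /WU[]]; first exact/set_mem/SC.
have [|V [oV Vy] VL] := perfect_on_tube _ KL.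
  by apply: bigcup_open => c _; exact: decomposable_open (dL' c).
exists V => //; exists L; split=> // x Px Vx.
by have [c _ Lx] := VL x Px Vx; exists c.
Qed.

Lemma perfect_on_dim_le : dim_le P (n + m.+1).
Proof.
move=> I U oU fU PU; have [cP fP kP] := pf.
have nX := lf_closed_refinable_normal rX.
have rY := perfect_image_lf_closed_refinable.
have [||D [oD YD DP]] := hurewicz_cover nX cf rY fibre_decomposable
    m.+1 (C := range U).
- by move=> _ [i _ <-].
- by move=> x /PU[i _ Ux]; exists (U i) => //; exists i.
have [J [V [oV YV mV VD]]] := dim_le_open_cover rY dT oD YD.
have [|||E [dE PE]] := order_decomposable (k := m.+1) (U := fun j => f @^-1` V j) rX cP.
- by move=> j; apply: open_comp => // x _; exact: cf.
- by move=> x Px; have [|j _ Vx] := YV (f x); [exists x | exists j].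
- by move=> x Px; apply: (mV (f x)); exists x.
have {}dE c : decomposable [set f @^-1` d | d in D] (E c).
  apply: decomposable_refine (dE c) => _ [j _ <-] [x Vx].
  have [|d Dd Vd] := VD j; first by exists (f x).
  by exists (f @^-1` d) => [|z /Vd//]; first by exists d.
have [H [O [cH _ _ PH HOE]]] :=
  lf_closed_refinable_shrink rX cP (fun c => decomposable_open (dE c)) PE.
have [||R [M [dM PM mM]]] := DP E H dE.
- exact: cH.
- by move=> c; have [HO OE] := HOE c; exact: subset_trans OE.
have /choice[mu muP] := dM.
have /choice[iota iotaP] u : exists o : option I,
    range U u -> exists2 i, o = Some i & U i = u.
  have [[i _ <-]|nu] := pselect (range U u); last by exists None.
  by exists (Some i) => _; exists i.
(* One [M r] may feed several [U i], but at each point only the one chosen for its piece there, so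
   regrouping does not raise the order. *)
exists (fun i => [set x | exists2 r, M r x & iota (mu r x) = Some i]); split.
- move=> i; rewrite openE => x [r Mx ix]; have [_ _] := muP r x Mx.
  by apply: filterS => z [Mz mz]; exists r => //; rewrite mz.
- move=> i x [r Mx ix]; have [/iotaP[j ij <-]] := muP r x Mx.
  by move: ij; rewrite ix => -[->].
- move=> x Px; have [|r Mx] := PM x Px; first by have [c _ Hx] := PH x Px; exists c.
  by have [/iotaP[i ij _] _ _] := muP r x Mx; exists i => //; exists r.
move=> x Px; apply: (mult_le_inj (R := fun i r => iota (mu r x) = Some i))
  (sum_mult_le (mM x Px)) => [i [r Mx ix]|i i' r -> []//].
by exists r.
Qed.

End Dimension.
End Perfect.

(** * Locally compact subgroups *)

Section Topological_group.
Variable X : topologicalGroupType.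
Implicit Types (a x : X) (U V W C K : set X).

Lemma mulg_continuous2 (Y : topologicalType) (f g : Y -> X) :
  continuous f -> continuous g -> continuous (fun y => f y * g y)%g.
Proof.
move=> cf cg y; apply: (@continuous_comp _ _ _ (fun y => (f y, g y))
  (fun p : X * X => (p.1 * p.2)%g)); last exact: mulg_continuous.
by apply: cvg_pair => /=; [exact: cf | exact: cg].
Qed.

Lemma lmulg_continuous a : continuous (fun x : X => a * x)%g.
Proof. by apply: mulg_continuous2 => x; [exact: cvg_cst | exact: cvg_id]. Qed.

Lemma rmulg_continuous a : continuous (fun x : X => x * a)%g.
Proof. by apply: mulg_continuous2 => x; [exact: cvg_id | exact: cvg_cst]. Qed.

Lemma nbhs_lmulg a V : nbhs (1%g : X) V -> nbhs a [set x | V (a^-1 * x)%g].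
Proof. by move=> V1; apply: (lmulg_continuous (a := a^-1%g)); rewrite mulVg. Qed.

Lemma nbhs_rmulg a V : nbhs (1%g : X) V -> nbhs a [set x | V (x * a^-1)%g].
Proof. by move=> V1; apply: (rmulg_continuous (a := a^-1%g)); rewrite mulgV. Qed.

Lemma nbhs1_mulg U : nbhs (1%g : X) U -> exists W, [/\ nbhs (1%g : X) W,
  forall x, W x -> W (x^-1)%g & forall x y, W x -> W y -> U (x * y)%g].
Proof.
move=> U1; have : nbhs ((1%g, 1%g) : X * X) [set p | U (p.1 * p.2)%g].
  by apply: mulg_continuous => /=; rewrite mulg1.
move=> [[A B] /= [A1 B1] AB]; pose W0 := A `&` B.
have W01 : nbhs (1%g : X) W0 by exact: filterI.
have W0V1 : nbhs (1%g : X) [set x | W0 (x^-1)%g].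
  by apply: invg_continuous; rewrite invg1.
exists (W0 `&` [set x | W0 (x^-1)%g]); split; first exact: filterI.
  by move=> x [Wx WVx]; split=> //=; rewrite invgK.
by move=> x y [[Ax _] _] [[_ By] _]; apply: (AB (x, y)).
Qed.

Lemma closure_mulg W V : nbhs (1%g : X) W -> (forall x, W x -> W (x^-1)%g) ->
  (forall x y, W x -> W y -> V (x * y)%g) -> closure W `<=` V.
Proof.
move=> W1 WV WWV x /(_ _ (nbhs_lmulg x W1))[y [Wy Wxy]].
have -> : x = (y * (x^-1 * y)^-1)%g by rewrite invgM invgK mulgA mulgV mul1g.
by apply: WWV => //; exact: WV.
Qed.

Lemma topological_group_regular : regular_space X.
Proof.
move=> a U Ua; have : nbhs (1%g : X) [set x | U (a * x)%g].
  by apply: (lmulg_continuous (a := a)); rewrite mulg1.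
move=> /nbhs1_mulg[W [W1 WV WU]].
exists [set x | W (a^-1 * x)%g]; first exact: nbhs_lmulg.
move=> x clx; suff : U (a * (a^-1 * x))%g by rewrite mulgA mulgV mul1g.
apply: (closure_mulg W1 WV WU) => N Nx.
have : nbhs x [set z | N (a^-1 * z)%g] by apply: lmulg_continuous.
by move=> /clx[z [Wz Nz]]; exists (a^-1 * z)%g.
Qed.

(** The set is the product [C K]. Each point outside it has, by compactness of [K], a neighbourhood
    that avoids it. *)
Lemma closed_mul_compact C K : closed C -> compact K ->
  closed [set x | exists2 g, K g & C (x * g^-1)%g].
Proof.
move=> cC cK; rewrite -[X in closed X]setCK; apply: open_closedC.
rewrite openE => x nCK; rewrite /interior.
have cdiv : continuous (fun p : X * X => p.2 * p.1^-1)%g.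
  apply: mulg_continuous2 => p; first exact: cvg_snd.
  by apply: (@continuous_comp _ _ _ fst (fun z : X => z^-1%g));
    [exact: cvg_fst | exact: invg_continuous].
have /compact_near_coveringP cover := cK.
have near_x : nbhs x [set z | K `<=` (fun g => ~ C (z * g^-1)%g)].
  apply: (cover X (nbhs x) (fun z g => ~ C (z * g^-1)%g)) => g Kg.
  have nC : nbhs (x * g^-1)%g (~` C).
    apply: open_nbhs_nbhs; split; first exact: closed_openC.
    by move=> Cxg; apply: nCK; exists g.
  exact: (cdiv (g, x) _ nC).
by apply: filterS near_x => z nz [g Kg Cz]; exact: nz Kg Cz.
Qed.

End Topological_group.

(** * The projection onto the coset space *)

Section Locally_compact_subgroup.
Variables (X : topologicalGroupType) (G : groupClosed X).
Hypothesis hX : hausdorff_space X.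

Definition coset_map (x : X) : coset_space G := (\pi_(coset_space G) x)%qT.

Lemma coset_map_continuous : continuous coset_map.
Proof. exact: pi_continuous. Qed.

Lemma coset_mapE x y : coset_map x = coset_map y <-> (x^-1 * y)%g \in G.
Proof. by split=> [/eqmodP|xy]; last exact/eqmodP. Qed.

(** The set in the hypothesis is the saturation [C G], the preimage of the image of [C]. *)
Lemma closed_coset_map (C : set X) :
  closed [set x | exists2 c, C c & (c^-1 * x)%g \in G] -> closed (coset_map @` C).
Proof.
move=> cCG; rewrite -[X in closed X]setCK; apply: open_closedC.
have : open (coset_map @^-1` (~` (coset_map @` C))); last by [].
rewrite (_ : _ @^-1` _ = ~` [set x | exists2 c, C c & (c^-1 * x)%g \in G]).
  exact: closed_openC.
apply/seteqP; split=> x nx [c Cc].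
  by move=> cx; apply: nx; exists c => //; exact/coset_mapE.
by move/coset_mapE => cx; apply: nx; exists c.
Qed.

Lemma subgroup_compact_nbhs :
  locally_compact [set: subgroup_type G] ->
  exists (O K : set X), [/\ nbhs (1%g : X) O, compact K,
    forall g, K g -> g \in G & forall g, g \in G -> O g -> K g].
Proof.
move=> /(_ 1%g I)[U U1 [cU _]].
pose v : subgroup_type G -> X := val.
have cv : continuous v by exact: initial_continuous.
have {}U1 : nbhs (1%g : subgroup_type G) U.
  by move: U1; rewrite withinET.
move: U1; rewrite nbhsE => -[B [[O oO OB] B1] BU].
exists O, (v @` U); split.
- apply: open_nbhs_nbhs; split=> //.
  by have : B 1%g by []; rewrite -OB.
- by apply: continuous_compact cU; exact: continuous_subspaceT.
- by move=> _ [g _ <-]; exact: (valP g).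
move=> g Gg Og; have vg : v (Sub g Gg) = g by exact: SubK.
exists (Sub g Gg) => //; apply: BU; rewrite -OB.
by move: Og; rewrite -{1}vg.
Qed.

(** Because [C] is small, the factors from [G] of points of [C G] near [x] all lie in one compact
    translate [K g0]. So near [x] the set [C G] coincides with [C K g0], which is closed. *)
Lemma closed_mul_subgroup (O W U1 U2 K C : set X) :
  nbhs (1%g : X) W -> (forall x, W x -> W (x^-1)%g) ->
  (forall x y, W x -> W y -> U2 (x * y)%g) ->
  (forall x, U2 x -> U2 (x^-1)%g) -> (forall x y, U2 x -> U2 y -> U1 (x * y)%g) ->
  (forall x y, U1 x -> U2 y -> O (x * y)%g) ->
  compact K -> (forall g, K g -> g \in G) -> (forall g, g \in G -> O g -> K g) ->
  closed C -> C `<=` U2 ->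
  closed [set x | exists2 c, C c & (c^-1 * x)%g \in G].
Proof.
move=> W1 WV WW U2V UU UO cK KG OK cC CU x clx.
have [z0 [[c0 Cc0 g0G] Wz0]] := clx _ (nbhs_rmulg x W1).
set g0 := (c0^-1 * z0)%g in g0G; pose K' := [set (k * g0)%g | k in K].
have cK' : compact K'.
  by apply: continuous_compact cK; apply: continuous_subspaceT; exact: rmulg_continuous.
have [|k [k0 Kk0 <-] Cxk] := closed_mul_compact cC cK' (t := x); last first.
  exists (x * (k0 * g0)^-1)%g => //.
  by rewrite invgM invgK -mulgA mulVg mulg1; apply: gpredM => //; exact: KG.
move=> N Nx; have [z [[c Cc cz] [Nz Wz]]] := clx _ (filterI Nx (nbhs_rmulg x W1)).
exists z; split=> //; exists (c^-1 * z)%g; last by rewrite invgM invgK mulgA mulgV mul1g.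
exists (c^-1 * z * g0^-1)%g; last by rewrite -mulgA mulVg mulg1.
apply: OK; first by apply: gpredM => //; rewrite gpredV.
(* The middle factor is [z z0^-1], small since [z] and [z0] are both near [x]; the outer factors are
   small since [C] lies in [U2]. *)
have -> : (c^-1 * z * g0^-1 = c^-1 * ((z * x^-1) * (z0 * x^-1)^-1) * c0)%g.
  by rewrite /g0 !invgM !invgK !mulgA mulgVK.
by apply: UO; [apply: UU; [exact/U2V/CU | apply: WW => //; exact: WV] | exact: CU].
Qed.

Lemma coset_map_perfect_on : locally_compact [set: subgroup_type G] ->
  exists2 P : set X, nbhs (1%g : X) P & forall a Q, closed Q ->
    Q `<=` [set x | P (a^-1 * x)%g] -> perfect_on coset_map Q.
Proof.
move=> /subgroup_compact_nbhs[O [K [O1 cK KG OK]]].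
have [U1 [U11 U1V UO]] := nbhs1_mulg O1.
have [U2 [U21 U2V UU]] := nbhs1_mulg U11.
have [W [W1 WV WW]] := nbhs1_mulg U21.
have U2U1 x : U2 x -> U1 x.
  by move=> U2x; rewrite -(mulg1 x); apply: UU => //; exact: nbhs_singleton.
have U1O x : U1 x -> O x.
  by move=> U1x; rewrite -(mulg1 x); apply: UO => //; exact: nbhs_singleton.
have clW : closure W `<=` U2 by exact: closure_mulg WW.
exists (closure W); first by apply: filterS W1; exact: subset_closure.
move=> a Q cQ QP; split=> // [C cC CQ|y].
  apply: closed_coset_map; pose C' := [set x | C (a * x)%g].
  have cC' : closed C'.
    by apply: closed_comp cC => x _; exact: lmulg_continuous.
  rewrite (_ : [set x | _] = (fun x => a^-1 * x)%g @^-1`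
      [set x | exists2 c, C' c & (c^-1 * x)%g \in G]); last first.
    apply/seteqP; split=> x [c Cc cx].
      exists (a^-1 * c)%g; first by rewrite /C' /= mulgA mulgV mul1g.
      by rewrite invgM invgK mulgA mulgK.
    by exists (a * c)%g => //; rewrite invgM -mulgA.
  apply: closed_comp => [x _|]; first exact: lmulg_continuous.
  apply: (closed_mul_subgroup W1 WV WW U2V UU _ cK KG OK cC').
    by move=> x z U1x /U2U1; exact: UO.
  move=> x C'x; apply: clW; have := QP _ (CQ _ C'x).
  by rewrite /= mulgA mulVg mul1g.
have [[p [Qp py]]|nQ] := pselect ((Q `&` coset_map @^-1` [set y]) !=set0); last first.
  rewrite (_ : _ `&` _ = set0); first exact: compact0.
  by apply/seteqP; split=> // x Qx; apply: nQ; exists x.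
(* Two points of [Q] in the same coset differ by an element of [G] lying in [O], hence in [K]. *)
have -> : Q `&` coset_map @^-1` [set y] = [set (p * g)%g | g in K] `&` Q.
  apply/seteqP; split=> x.
    move=> [Qx xy]; split=> //; exists (p^-1 * x)%g.
      apply: OK; first by apply/coset_mapE; rewrite xy py.
      have -> : (p^-1 * x = (a^-1 * p)^-1 * (a^-1 * x))%g.
        by rewrite invgM invgK mulgA mulgK.
      by apply/U1O/UU; [apply: U2V|]; apply: clW; exact: QP.
    by rewrite mulgA mulgV mul1g.
  move=> [[g Kg <-] Qg]; split=> //=; rewrite -py; apply/esym/coset_mapE.
  by rewrite mulgA mulVg mul1g; exact: KG.
apply: compact_closedI => //; apply: continuous_compact cK.
by apply: continuous_subspaceT; exact: lmulg_continuous.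
Qed.

(** For a point [p] of the fibre, [g] to [p g] identifies a closed subset of [G] with the fibre. *)
Lemma coset_fibre_dim_le (Q : set X) (y : coset_space G) k :
  closed Q -> cover_multiplicity_le (subgroup_type G) k ->
  dim_le (Q `&` coset_map @^-1` [set y]) k.
Proof.
move=> cQ Gk; set F := Q `&` _.
have [[p [Qp py]]|nF] := pselect (F !=set0); last exact: dim_le0.
pose v : subgroup_type G -> X := val.
pose h (g : subgroup_type G) := (p * v g)%g.
have ch : continuous h.
  have cv : continuous v by exact: initial_continuous.
  move=> g; apply: (@continuous_comp _ _ _ v (fun x => p * x)%g); first exact: cv.
  exact: lmulg_continuous.
have hF g : F (h g) <-> Q (h g).
  split=> [[]//|Qg]; split=> //=; rewrite -py; apply/esym/coset_mapE.
  by rewrite mulgA mulVg mul1g; exact: (valP g).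
have Fh x : F x -> exists g, h g = x.
  move=> [_ xy]; have Gx : (p^-1 * x)%g \in G by apply/coset_mapE; rewrite xy py.
  have vx : v (Sub (p^-1 * x)%g Gx) = (p^-1 * x)%g by exact: SubK.
  by exists (Sub (p^-1 * x)%g Gx); rewrite /h vx mulgA mulgV mul1g.
have cF : closed (h @^-1` F).
  rewrite (_ : _ @^-1` F = h @^-1` Q); last by apply/seteqP; split=> g /hF.
  by apply: closed_comp => // g _; exact: ch.
move=> I U oU fU FU.
have [|||W [oW WU FW mW]] := cover_multiplicity_dim_le Gk cF (U := fun i => h @^-1` U i).
- by move=> i; apply: open_comp => // g _; exact: ch.
- by apply: sub_finite_set fU => i [g [Ug Fg]]; exists (h g).
- by move=> g /FU[i _ Ug]; exists i.
(* Open sets of [G] are traces of open sets of [X]; translating these by [p] extends the shrinking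
   to the whole group. *)
have /choice[O OP] i : exists O, open O /\ v @^-1` O = W i.
  by have [O oO OW] := oW i; exists O.
have OW i g : O i (p^-1 * h g)%g = W i g.
  by have [_ <-] := OP i; rewrite /h mulgA mulVg mul1g.
exists (fun i => U i `&` [set x | O i (p^-1 * x)%g]); split.
- move=> i; apply: openI; first exact: oU.
  have [oO _] := OP i; apply: open_comp oO => x _; exact: lmulg_continuous.
- by move=> i x [].
- move=> x Fx; have [g ge] := Fh x Fx; have [|i _ Wg] := FW g; first by rewrite /= ge.
  by exists i => //; split; rewrite -ge; [exact: WU | rewrite /= OW].
move=> x Fx; have [g ge] := Fh x Fx.
have : mult_le W k g by apply: mW; rewrite /= ge.
by move=> mg s us sW; apply: mg => // i /sW[_]; rewrite -ge /= OW.
Qed.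

(** Translates of a small neighbourhood cover [X]; on the pieces of a locally finite closed
    refinement the projection is perfect, and the sum theorem collects the bounds. *)
Lemma locally_compact_coset_cover_multiplicity (m n : nat) :
  paracompact_space X -> locally_compact [set: subgroup_type G] ->
  cover_multiplicity_le (coset_space G) m.+1 ->
  cover_multiplicity_le (subgroup_type G) n.+1 ->
  cover_multiplicity_le X (n + m.+1).
Proof.
move=> pX lG Xm Gn; apply: dim_le_cover_multiplicity => I U oU fU XU.
have rX := paracompact_lf_closed_refinable (@topological_group_regular X) pX.
have [P P1 PQ] := coset_map_perfect_on lG.
have [||J [A [cA fA AX rA]]] := rX (range (fun a => [set x | P (a^-1 * x)%g]^°)).
- by move=> _ [a _ <-]; exact: open_interior.
- by move=> a _; exists [set x | P (a^-1 * x)%g]^°; [exists a | exact: nbhs_lmulg].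
have [|||W [oW WU AW mW]] := locally_finite_sum (k := n + m.+1) oU cA fA.
- move=> j; have [Aj|/dim_le0//] := pselect (A j !=set0).
  have [_ [a _ <-] AP] := rA j Aj.
  have pA : perfect_on coset_map (A j).
    by apply: (PQ a) => //; apply: subset_trans AP _; exact: interior_subset.
  apply: (perfect_on_dim_le hX rX coset_map_continuous pA) => [B cB|y].
    exact: cover_multiplicity_dim_le.
  exact: coset_fibre_dim_le.
- by move=> j; apply: sub_finite_set fU => i [x [Ux _]]; exists x.
- by move=> j x _; exact: XU.
have AT x : exists j, A j x by have : setT x by []; rewrite -AX => -[j _]; exists j.
by exists W; split=> // x _; have [j Ax] := AT x; [exact: AW Ax | exact: mW Ax].
Qed.

End Locally_compact_subgroup.

(** A nonempty space has dimension at least 0, so the minimal orders can be written [m + 1] and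
    [n + 1]. *)
Lemma cover_multiplicity_gt0 (T : topologicalType) (x : T) k :
  cover_multiplicity_le T k -> (0 < k)%N.
Proof.
case: k => // /(_ [set setT])[||D [_ [_ DT] _ mD]].
- exact: finite_set1.
- by split=> [_ -> |]; [exact: openT | rewrite bigcup_set1].
have : setT x by []; rewrite -DT => -[V DV Vx].
have /(mult_leP (fun V => [set y | D V /\ V y])) D0 := mD x.
suff : (1 <= 0)%N by [].
by apply: (D0 [:: V]) => // i; rewrite inE => /eqP ->.
Qed.

Theorem theorem1p12 (X : topologicalGroupType) (G : groupClosed X) :
  hausdorff_space X -> paracompact_space X ->
  almost_connected (subgroup_type G) ->
  (covering_dim X <= covering_dim (coset_space G)
                     + covering_dim (subgroup_type G))%E.
Proof.
move=> hX pX [lG _]; rewrite [covering_dim (coset_space G)]/covering_dim.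
rewrite [covering_dim (subgroup_type G)]/covering_dim.
(* If either dimension on the right is infinite, so is the sum, as finite values are integers. *)
case: pselect => [exX|_]; case: pselect => [exG|_]; rewrite ?leey //.
case: ex_minnP => k1 /asboolP k1P _; case: ex_minnP => k2 /asboolP k2P _.
have k1_gt0 := cover_multiplicity_gt0 (coset_map G 1%g) k1P.
have k2_gt0 := cover_multiplicity_gt0 (1%g : subgroup_type G) k2P.
case: k1 k1P k1_gt0 => // m mP _; case: k2 k2P k2_gt0 => // n nP _.
have := locally_compact_coset_cover_multiplicity hX pX lG mP nP.
rewrite /covering_dim => nmP; case: pselect => [exT|[]]; last first.
  by exists (n + m.+1)%N; apply/asboolP.
case: ex_minnP => k _ /(_ (n + m.+1)%N); move=> /(_ (introT (asboolP _) nmP)) kle.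
have predS p : (Posz p.+1 - 1)%R = Posz p by rewrite intS [(1 + _)%R]addrC addrK.
rewrite !predS -EFinD lee_fin lerBlDr.
have -> : (Posz m + Posz n + 1)%R = Posz (n + m.+1).
  by rewrite addnS -addn1 !PoszD [(Posz n + _)%R]addrC.
by rewrite lez_nat.
Qed.
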